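(* Let $G$ be any graph. If $\mathscr C^\alpha$ is a $\mathscr C$-system of $G$, then $\alpha G$ (together with the map $\mathrm{id}_G\cup\iota^\alpha\colon|G|_\Omega\to\alpha G$) is an $\Omega$-compactification of $G$.
   Context: Graph notation. $G=(V,E)$ is a graph, $\mathcal X$ is the set of all finite subsets of $V$, directed by inclusion; for $X\in\mathcal X$, $\mathcal C_X$ is the set of components of $G-X$, with the discrete topology; for $X\subseteq X'$, $\mathfrak c_{X',X}\colon\mathcal C_{X'}\to\mathcal C_X$ sends each component of $G-X'$ to the component of $G-X$ including it. A ray is a 1-way infinite path; two rays are equivalent if for every $X\in\mathcal X$ both have a tail in the same component of $G-X$; ends are equivalence classes of rays, $\Omega$ is the set of ends, $C(X,\omega)$ is the component of $G-X$ in which the rays of $\omega$ have a tail; $\omega$ is identified with $(C(X,\omega)\mid X\in\mathcal X)$, so $\Omega=\varprojlim\mathcal C_X$ (a known theorem of Diestel and Kühn). Topology. $G$ also denotes its 1-complex, with point set $V\sqcup\bigsqcup_{e\in E}\mathring e$, where each edge $e=xy$ is a homeomorphic copy $\{x\}\sqcup\mathring e\sqcup\{y\}$ of $[0,1]$ with $\mathring e$ corresponding to $(0,1)$; basic open neighbourhoods of points of $\mathring e$ are inherited from $(0,1)$, and those of a vertex $v$ are the unions $\bigcup_{e\ni v}[v,i_e)$ of half-open intervals with $i_e\in\mathring e$ arbitrary. For $F\subseteq E$, $\mathring F=\bigsqcup_{e\in F}\mathring e$ (never a topological interior); $E(X,\bigcup\mathcal C)$ is the set of edges between $X$ and $\bigcup\mathcal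 C$. $|G|_\Omega=G\sqcup\Omega$ has the topology generated by the open sets of $G$ and all sets $\bigcup\mathcal C\cup\mathring E(X,\bigcup\mathcal C)\cup\{\omega\in\Omega\mid C(X,\omega)\in\mathcal C\}$ with $X\in\mathcal X$, $\mathcal C\subseteq\mathcal C_X$. Compactifications. A compactification of a space $Y$ is a pair $(K,h)$ with $K$ compact (not necessarily Hausdorff) and $h\colon Y\to K$ an embedding with dense image. An $\Omega$-compactification of $G$ is a compactification $\alpha G$ of $|G|_\Omega$ such that $\alpha G\setminus\mathring E$ is a Hausdorff compactification of $|G|_\Omega\setminus\mathring E$. $\mathscr C$-systems. A $\mathscr C$-system of $G$ is an inverse system $\mathscr C^\alpha=\{(\alpha(\mathcal C_X),\alpha_X),\mathfrak a_{X',X},\mathcal X\}$ of Hausdorff compactifications $(\alpha(\mathcal C_X),\alpha_X)$ of the discrete spaces $\mathcal C_X$, with continuous compatible bonding maps $\mathfrak a_{X',X}\colon\alpha(\mathcal C_{X'})\to\alpha(\mathcal C_X)$ satisfying $\mathfrak a_{X',X}\circ\alpha_{X'}=\alpha_X\circ\mathfrak c_{X',X}$ for all $X\subseteq X'\in\mathcal X$. Let $\mathcal I^\alpha=\varprojlim\alpha(\mathcal C_X)$, with continuous projections $\pi_X^\alpha\colon\mathcal I^\alpha\to\alpha(\mathcal C_X)$, and let $\iota^\alpha\colon\Omega\to\mathcal I^\alpha$, $(C_X\mid X\in\mathcal X)\mapsto(\alpha_X(C_X)\mid X\in\mathcal X)$, which is injective. $\alpha G=G\sqcup\mathcal I^\alpha$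 carries the topology generated by the open sets of $G$ and, for all $X\in\mathcal X$ and all open $O\subseteq\alpha(\mathcal C_X)$, the sets $\bigcup\mathcal C\cup\mathring E(X,\bigcup\mathcal C)\cup(\pi_X^\alpha)^{-1}(O)$ where $\mathcal C=\alpha_X^{-1}(O)\subseteq\mathcal C_X$. *)

(* Defs.v *)
From HB Require Import structures.
From mathcomp Require Import all_boot all_order all_algebra finmap.
From mathcomp Require Import all_classical all_reals all_analysis.

Set Implicit Arguments.
Unset Strict Implicit.
Unset Printing Implicit Defensive.

Import Order.TTheory GRing.Theory Num.Theory.
Import numFieldNormedType.Exports.

Local Open Scope classical_set_scope.
Local Open Scope ring_scope.

Section Compactifications.
Implicit Types Y K : topologicalType.

Definition embedding Y K (h : Y -> K) : Prop :=
  [/\ injective h,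
      continuous h &
      forall U : set Y, open U ->
        exists2 W : set K, open W & h @` U = W `&` range h].

(* [compact] is the filter-based notion and does not include Hausdorff. *)
Definition compactification Y K (h : Y -> K) : Prop :=
  [/\ compact [set: K], embedding h & dense (range h)].

Definition hausdorff_compactification Y K (h : Y -> K) : Prop :=
  compactification h /\ hausdorff_space K.

End Compactifications.

(* Graphs are simple, as is implied by writing an edge as e = xy; they may be
   empty, infinite or of infinite degree.  Since every type carries a choice
   structure classically, [choiceType] is no restriction on the vertex set. *)
Record graph := Graph {
  vertex :> choiceType;
  adj : rel vertex;
  adj_sym : symmetric adj;
  adj_irr : irreflexive adj
}.

Section Ends.
Variable G : graph.
Implicit Types X : {fset G}.

Definition adj_minus X : rel G :=
  fun u v => [&& adj u v, u \notin X & v \notin X].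

Definition component_of X (v : G) : set G :=
  [set w | exists2 p : seq G, path (adj_minus X) v p & last v p = w].

(* A component of G - X, being an induced subgraph, is represented by its
   vertex set. *)
Definition components X : set (set G) :=
  [set component_of X v | v in [set v | v \notin X]].

Definition component X : Type := set_type (components X).
HB.instance Definition _ X := Choice.copy (component X) (set_type (components X)).

Definition component_set X (C : component X) : set G := val C.

Record ray := Ray {
  ray_vertex :> nat -> G;
  ray_inj : injective ray_vertex;
  ray_adj : forall n, adj (ray_vertex n) (ray_vertex n.+1)
}.

Definition has_tail_in (r : ray) (C : set G) : Prop :=
  exists N, forall n, (N <= n)%N -> C (r n).

Definition ray_equiv (r r' : ray) : Prop :=
  forall X, exists C : component X,
    has_tail_in r (component_set C) /\ has_tail_in r' (component_set C).

Definition ends : set (set ray) := range (fun r => [set r' | ray_equiv r r']).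

Definition Omega : Type := set_type ends.
HB.instance Definition _ := Choice.copy Omega (set_type ends).

Definition end_rays (w : Omega) : set ray := val w.

Lemma component_of_refl X v : component_of X v v.
Proof. by exists [::]. Qed.

Lemma component_of_trans X u v w :
  component_of X u v -> component_of X v w -> component_of X u w.
Proof.
by move=> [p pp <-] [q qq <-]; exists (p ++ q); rewrite ?cat_path ?pp ?last_cat.
Qed.

Lemma component_of_sym X u v : component_of X u v -> component_of X v u.
Proof.
move=> [p pp <-]; exists (rev (belast u p)).
  rewrite rev_path; apply: sub_path pp => a b; rewrite /adj_minus adj_sym.
  by case/and3P=> -> -> ->.
by case: p {pp} => //= x p; rewrite rev_cons last_rcons.
Qed.

Lemma component_eq X (C D : component X) v :
  component_set C v -> component_set D v -> C = D.
Proof.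
suff CE (E : component X) : component_set E v ->
    component_set E = component_of X v.
  by move=> /CE eC /CE eD; apply: val_inj; exact: etrans eC (esym eD).
have := set_valP E; rewrite /component_set => -[u _ <-] uv.
apply/seteqP; split=> w.
  by apply: component_of_trans; exact: component_of_sym.
exact: component_of_trans.
Qed.

Lemma has_tail_in_component_eq X (C D : component X) (r : ray) :
  has_tail_in r (component_set C) -> has_tail_in r (component_set D) -> C = D.
Proof.
move=> [M CM] [N DN].
by apply: (@component_eq X C D (r (maxn M N)));
  [apply: CM; exact: leq_maxl | apply: DN; exact: leq_maxr].
Qed.

Lemma ray_component X (r : ray) :
  exists C : component X, has_tail_in r (component_set C).
Proof.
have [N rN] : exists N, forall n, (N <= n)%N -> r n \notin (X : seq G).
  elim: (X : seq G) => [|a s [N IH]]; first by exists 0%N.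
  have [[m ram]|nra] := pselect (exists m, r m = a).
    exists (maxn m.+1 N) => n; rewrite geq_max => /andP[mn Nn].
    rewrite in_cons negb_or IH // andbT -ram; apply/eqP => /ray_inj nm.
    by rewrite nm ltnn in mn.
  exists N => n Nn; rewrite in_cons negb_or IH // andbT.
  by apply/eqP => rna; apply: nra; exists n.
have XC : components X (component_of X (r N)) by exists (r N) => //=; exact: rN.
exists (exist (fun C => C \in components X) _ (mem_set XC)); exists N => n /subnK <-.
elim: (n - N)%N => [|k IH]; first exact: component_of_refl.
apply: component_of_trans IH _; exists [:: r (k + N).+1] => //=.
by rewrite andbT /adj_minus ray_adj !rN // ?leqW // leq_addl.
Qed.

Lemma end_component_ex X (w : Omega) :
  exists C : component X, forall r, end_rays w r -> has_tail_in r (component_set C).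
Proof.
have [r0 _ wE] := set_valP w; have [C r0C] := ray_component X r0.
exists C => r; rewrite /end_rays -wE => /(_ X)[D [r0D rD]].
by rewrite (has_tail_in_component_eq r0C r0D).
Qed.

Definition end_component X (w : Omega) : component X :=
  sval (cid (end_component_ex X w)).

Lemma end_componentP X (w : Omega) r :
  end_rays w r -> has_tail_in r (component_set (end_component X w)).
Proof. by rewrite /end_component; case: cid => C /= /(_ r). Qed.

Lemma component_map_ex X X' (sXX' : (X `<=` X')%fset) (C' : component X') :
  exists C : component X, component_set C' `<=` component_set C.
Proof.
have [v /= vX' C'E] := set_valP C'.
have sub a : a \notin X' -> a \notin X by apply: contra; exact: (fsubsetP sXX').
have XC : components X (component_of X v) by exists v => //=; exact: sub.
exists (exist (fun C => C \in components X) _ (mem_set XC)) => w.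
rewrite (_ : component_set C' = component_of X' v) // => -[p pp <-].
exists p => //; apply: sub_path pp => a b /and3P[ab aX' bX'].
by rewrite /adj_minus ab !sub.
Qed.

Definition component_map X X' (sXX' : (X `<=` X')%fset) (C' : component X') :
  component X := sval (cid (component_map_ex sXX' C')).

Lemma component_mapP X X' (sXX' : (X `<=` X')%fset) (C' : component X') :
  component_set C' `<=` component_set (component_map sXX' C').
Proof. by rewrite /component_map; case: cid. Qed.

Lemma end_component_map X X' (sXX' : (X `<=` X')%fset) (w : Omega) :
  component_map sXX' (end_component X' w) = end_component X w.
Proof.
have [r0 _ wE] := set_valP w.
have wr0 : end_rays w r0.
  rewrite /end_rays -wE => X0; have [C r0C] := ray_component X0 r0.
  by exists C.
apply: (has_tail_in_component_eq (r := r0)); last exact: end_componentP.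
have [N r0N] := end_componentP X' wr0.
by exists N => n /r0N; exact: component_mapP.
Qed.

End Ends.

Section OneComplex.
Variables (R : realType) (G : graph).

Definition edges : set (set G) :=
  [set e | exists x y : G, adj x y /\ e = [set x; y]].

Definition edge : Type := set_type edges.
HB.instance Definition _ := Choice.copy edge (set_type edges).

Definition edge_set (e : edge) : set G := val e.

Lemma edge_ends_ex (e : edge) :
  exists xy : G * G, adj xy.1 xy.2 /\ edge_set e = [set xy.1; xy.2].
Proof. by have [x [y [xy eE]]] := set_valP e; exists (x, y). Qed.

(* The end of e that corresponds to 0 under the homeomorphism between e and
   [0, 1].  The choice is arbitrary and does not affect the topology. *)
Definition edge_origin (e : edge) : G := (sval (cid (edge_ends_ex e))).1.

Definition I01 : Type := set_type (`]0, 1[%classic : set R).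
HB.instance Definition _ :=
  Topological.copy I01 (set_type (`]0, 1[%classic : set R)).

(* The 1-complex of G: [inl v] is the vertex v, and [inr (e, s)] is the point
   of the open edge e that corresponds to s in (0, 1). *)
Definition complex : Type := (G + edge * I01)%type.
HB.instance Definition _ := Choice.copy complex (G + edge * I01)%type.

(* Distance on e = [0, 1] from the end v of e to the interior point s. *)
Definition end_dist (v : G) (e : edge) (s : I01) : R :=
  if v == edge_origin e then val s else 1 - val s.

(* The union of the half-open intervals [v, i e) over the edges e at v. *)
Definition star (v : G) (i : edge -> I01) : set complex :=
  [set p | match p with
           | inl u => u = v
           | inr (e, s) => edge_set e v /\ end_dist v e s < end_dist v e (i e)
           end].

Definition complex_open : set_system complex :=
  [set U | (forall e, open [set s : I01 | U (inr (e, s))]) /\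
           (forall v, U (inl v) -> exists i : edge -> I01, star v i `<=` U)].

Lemma complex_openT : complex_open setT.
Proof.
have half : `]0, 1[%classic (2^-1 : R).
  by rewrite /= in_itv /= invr_gt0 ltr0n invf_lt1 ?ltr0n // ltr1n.
split=> [e|v _]; first exact: openT.
by exists (fun=> exist (fun x => x \in `]0, 1[%classic) _ (mem_set half)).
Qed.

Lemma complex_openI : setI_closed complex_open.
Proof.
move=> A B [eA vA] [eB vB]; split=> [e|v [/vA[i iA] /vB[j jB]]].
  exact: openI (eA e) (eB e).
exists (fun e => if end_dist v e (i e) <= end_dist v e (j e)
                 then i e else j e).
case=> [u /= ->|[e s] /= [ev]]; first by split; [exact: iA | exact: jB].
case: ifPn => [ij si|]; last rewrite -ltNge => ji sj.
  by split; [apply: iA | apply: jB]; split=> //=; exact: lt_le_trans si ij.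
by split; [apply: iA | apply: jB]; split=> //=; exact: lt_trans sj ji.
Qed.

Lemma complex_open_bigU (I : Type) (f : I -> set complex) :
  (forall i, complex_open (f i)) -> complex_open (\bigcup_i f i).
Proof.
move=> fo; split=> [e|v [k _ /(proj2 (fo k))[i iU]]]; last first.
  by exists i => p /iU; exists k.
rewrite (_ : [set s | _] = \bigcup_k [set s | f k (inr (e, s))]) //.
by apply: bigcup_open => k _; exact: (proj1 (fo k)).
Qed.

HB.instance Definition _ := isOpenTopological.Build complex
  complex_openT complex_openI complex_open_bigU.

(* The union of the open edges in F. *)
Definition open_edges (F : set edge) : set complex :=
  [set p | exists e s, F e /\ p = inr (e, s)].

Definition edges_between (A B : set G) : set edge :=
  [set e | exists x y : G, [/\ A x, B y & edge_set e = [set x; y]]].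

Definition component_points (X : {fset G}) (C : component X) : set complex :=
  inl @` component_set C
  `|` open_edges [set e | edge_set e `<=` component_set C].

(* The part in the 1-complex of the generating open sets of |G|_Omega and of
   alpha G. *)
Definition components_nbhd (X : {fset G}) (Cs : set (component X)) :
    set complex :=
  \bigcup_(C in Cs) component_points C
  `|` open_edges (edges_between [set` X] (\bigcup_(C in Cs) component_set C)).

Definition end_space : Type := (complex + Omega G)%type.
HB.instance Definition _ := Choice.copy end_space (complex + Omega G)%type.

Definition end_nbhd (X : {fset G}) (Cs : set (component X)) : set end_space :=
  inl @` components_nbhd Cs `|` inr @` [set w | Cs (end_component X w)].

Definition end_space_subbase : set_system end_space :=
  [set B | (exists2 U : set complex, open U & B = inl @` U) \/
           (exists X (Cs : set (component X)), B = end_nbhd Cs)].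

HB.instance Definition _ :=
  isSubBaseTopological.Build end_space end_space_subbase id.

Definition end_space_edges : set end_space := inl @` open_edges setT.

(* The open edges are removed from K through h, and the restriction of h to
   the remaining subspaces, which is unique if it exists, is named h'. *)
Definition Omega_compactification (K : topologicalType) (h : end_space -> K) :
    Prop :=
  compactification h /\
  exists h' : set_type (~` end_space_edges) ->
              set_type (~` (h @` end_space_edges)),
    (forall p, val (h' p) = h (val p)) /\ hausdorff_compactification h'.

End OneComplex.

Record Csystem (G : graph) := CSystem {
  csys_space : {fset G} -> topologicalType;
  csys_map : forall X : {fset G},
    discrete_topology (component X) -> csys_space X;
  csys_bond : forall X X' : {fset G}, (X `<=` X')%fset ->
    csys_space X' -> csys_space X;
  csys_compactification : forall X, hausdorff_compactification (@csys_map X);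
  csys_bond_continuous : forall X X' (s : (X `<=` X')%fset),
    continuous (csys_bond s);
  csys_bond_id : forall X (s : (X `<=` X)%fset), csys_bond s =1 id;
  csys_bond_comp : forall X X' X'' (s : (X `<=` X')%fset)
    (s' : (X' `<=` X'')%fset) (s'' : (X `<=` X'')%fset),
    csys_bond s \o csys_bond s' =1 csys_bond s'';
  csys_bond_map : forall X X' (s : (X `<=` X')%fset),
    csys_bond s \o @csys_map X' =1 @csys_map X \o component_map s
}.

Section AlphaG.
Variables (R : realType) (G : graph) (A : Csystem G).

Definition csys_threads : set (prod_topology (csys_space A)) :=
  [set x | forall X X' (s : (X `<=` X')%fset), csys_bond s (x X') = x X].

(* As a subspace of the product, this carries the inverse limit topology. *)
Definition csys_limit : Type := set_type csys_threads.
HB.instance Definition _ := Topological.copy csys_limit (set_type csys_threads).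

Definition csys_proj (X : {fset G}) (x : csys_limit) : csys_space A X :=
  (val x : prod_topology (csys_space A)) X.

Lemma end_thread (w : Omega G) :
  csys_threads (fun X => csys_map A (end_component X w)).
Proof.
move=> X X' s; have := csys_bond_map A s (end_component X' w).
by move=> /= ->; rewrite end_component_map.
Qed.

Definition csys_iota (w : Omega G) : csys_limit :=
  exist (fun x => x \in csys_threads) _ (mem_set (end_thread w)).

Definition alpha_space : Type := (complex R G + csys_limit)%type.
HB.instance Definition _ :=
  Choice.copy alpha_space (complex R G + csys_limit)%type.

Definition alpha_nbhd (X : {fset G}) (O : set (csys_space A X)) :
    set alpha_space :=
  inl @` components_nbhd (csys_map A (X := X) @^-1` O)
  `|` inr @` (csys_proj X @^-1` O).

Definition alpha_subbase : set_system alpha_space :=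
  [set B | (exists2 U : set (complex R G), open U & B = inl @` U) \/
           (exists X (O : set (csys_space A X)), open O /\ B = alpha_nbhd O)].

HB.instance Definition _ :=
  isSubBaseTopological.Build alpha_space alpha_subbase id.

Definition alpha_map (p : end_space R G) : alpha_space :=
  match p with
  | inl x => inl x
  | inr w => inr (csys_iota w)
  end.

End AlphaG.

(* Main.v *)
Require Import Defs.
From mathcomp Require Import all_boot all_order all_algebra finmap.
From mathcomp Require Import all_classical all_reals all_analysis.

Set Implicit Arguments.
Unset Strict Implicit.
Unset Printing Implicit Defensive.

Import Order.TTheory GRing.Theory Num.Theory.
Import numFieldNormedType.Exports.

Local Open Scope classical_set_scope.
Local Open Scope ring_scope.

(* Every point of alpha G outside the finite subgraph G[X] lies over a unique
   point of alpha(C_X), and this partial map is compatible with the bonding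
   maps.  For compactness, take an ultrafilter F on alpha G.  If F contains some
   G[X], which is compact, then F converges in G[X].  Otherwise, F pushes
   forward to every compact Hausdorff space alpha(C_X); the limits form a
   thread, and F converges to it.  Outside the open edges, distinct threads are
   separated in some alpha(C_X), and vertices are isolated. *)

(** * Generated topologies and compact subspaces *)

(** Open sets of a generated topology are unions of finite intersections of subbasic sets, so a
    property preserved by these operations only has to be checked on the subbase. *)
Lemma subbase_ind (T : choiceType) (D P : set_system T) :
  P setT -> setI_closed P ->
  (forall (I : Type) (f : I -> set T),
    (forall i, P (f i)) -> P (\bigcup_i f i)) ->
  D `<=` P ->
  [set \bigcup_(B in D') B | D' in subset^~ (finI_from D id)] `<=` P.
Proof.
move=> PT PI PU DP _ [D' D'D <-]; rewrite bigcup_set_type.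
apply: PU => -[B /set_mem /= /D'D[E ED <-]]; rewrite bigcap_fset big_seq_cond.
by apply: (big_ind (P : set T -> Prop)) => // C /andP[/ED/set_mem/DP].
Qed.

Lemma subbase_gen (T : choiceType) (D : set_system T) :
  D `<=` [set \bigcup_(B in D') B | D' in subset^~ (finI_from D id)].
Proof.
move=> B DB; exists [set B]; last by rewrite bigcup_set1.
by move=> _ ->; apply: finI_from1.
Qed.

(** A filter on the subtype is pushed forward along [val]; a cluster point of the image inside [A]
    is a cluster point of the original filter, since subspace neighbourhoods are traces. *)
Lemma compact_set_type (T : topologicalType) (A : set T) :
  compact A -> compact [set: set_type A].
Proof.
move=> Aco F FF _; have [|p [Ap Fp]] := Aco (val @ F).
  by rewrite /fmap /=; apply: filterS filterT => q _; exact: set_valP.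
exists (exist (fun x => x \in A) p (mem_set Ap)); split => // B N FB.
move=> -[_ [[W Wo <-] /= Wp WN]].
have [||_ [[b Bb <-] Wb]] := Fp (val @` B) W.
- by rewrite /fmap /=; apply: filterS FB => b Bb; exists b.
- exact: open_nbhs_nbhs.
by exists b; split=> //; exact: WN.
Qed.

(** * Restricting an embedding to the complement of a set *)

Section Restriction.
Variables (Y K : topologicalType) (h : Y -> K) (E : set Y).
Hypothesis emb : embedding h.

Lemma notin_image_embedding (p : set_type (~` E)) : (~` (h @` E)) (h (val p)).
Proof.
have [hinj _ _] := emb.
by move=> [q Eq /hinj qp]; apply: (set_valP p); rewrite -qp.
Qed.

Definition embedding_restriction (p : set_type (~` E)) :
    set_type (~` (h @` E)) :=
  exist (fun x => x \in ~` (h @` E)) _ (mem_set (@notin_image_embedding p)).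

Lemma embedding_restriction_embedding : embedding embedding_restriction.
Proof.
have [hinj hcont hopen] := emb; split.
- by move=> p q /(congr1 val) /= /hinj /val_inj.
- apply/continuousP => _ [W Wo <-].
  exists (h @^-1` W) => //; move/continuousP : hcont; exact.
move=> _ [U Uo <-]; have [W Wo hU] := hopen _ Uo.
exists (val @^-1` W); first by exists W.
apply/seteqP; split=> [_ [p /= Up <-]|q [/= Wq [p _ pq]]].
  split; last by exists p.
  by have [] : (W `&` range h) (h (val p)) by rewrite -hU; exists (val p).
have [y Uy yq] : (h @` U) (val q).
  by rewrite hU; split => //; exists (val p); rewrite -?pq.
by rewrite -pq in yq; have yp := hinj _ _ yq; rewrite yp in Uy; exists p.
Qed.

End Restriction.

(** * Components of G - X and edges *)

Section Components.
Variable G : graph.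
Implicit Types X : {fset G}.

Lemma component_setE X (C : component X) :
  exists2 u, u \notin X & component_set C = component_of X u.
Proof. by have [u uX uC] := set_valP C; exists u. Qed.

Lemma component_ex X v :
  v \notin X -> exists C : component X, component_set C v.
Proof.
move=> vX; have XC : components X (component_of X v) by exists v.
exists (exist (fun C => C \in components X) _ (mem_set XC)).
exact: component_of_refl.
Qed.

Lemma component_nonempty X (C : component X) : exists v, component_set C v.
Proof.
by have [u _ ->] := component_setE C; exists u; exact: component_of_refl.
Qed.

Lemma component_notin X (C : component X) v : component_set C v -> v \notin X.
Proof.
have [u uX ->] := component_setE C; move=> [p + <-].
elim: p u uX => //= w p IH u uX /andP[/and3P[_ _ wX]]; exact: IH.
Qed.

Lemma component_adj X (C : component X) u v :
  component_set C u -> adj u v -> v \notin X -> component_set C v.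
Proof.
move=> Cu uv vX; have uX := component_notin Cu.
have [w _ CE] := component_setE C; move: Cu; rewrite CE => wu.
apply: component_of_trans wu _; exists [:: v] => //=.
by rewrite /adj_minus uv uX vX.
Qed.

Lemma edge_adj (e : edge G) u v :
  edge_set e u -> edge_set e v -> u != v -> adj u v.
Proof.
have [[x y] /= [xy ->]] := edge_ends_ex e.
by move=> [->|->] [->|->]; rewrite ?eqxx // adj_sym.
Qed.

Lemma edge_component_eq X (C D : component X) (e : edge G) u v :
  edge_set e u -> edge_set e v -> component_set C u -> component_set D v ->
  C = D.
Proof.
move=> eu ev Cu Dv; have [uv|/(edge_adj eu ev) uv] := eqVneq u v.
  by rewrite -uv in Dv; exact: component_eq Cu Dv.
exact: component_eq (component_adj Cu uv (component_notin Dv)) Dv.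
Qed.

End Components.

(** * The 1-complex: neighbourhoods of components, and compactness of finite subgraphs *)

Section Complex.
Variables (R : realType) (G : graph).
Implicit Types (X : {fset G}) (e : edge G).

(** One end in [C] suffices, so that the open edges inside a component and those joining it to [X]
    are treated alike. *)
Definition incident (C : set G) (p : complex R G) : Prop :=
  match p with
  | inl v => C v
  | inr (e, _) => exists2 v, edge_set e v & C v
  end.

Lemma incident_eq X (C D : component X) p :
  incident (component_set C) p -> incident (component_set D) p -> C = D.
Proof.
case: p => [v|[e s]] /=; first exact: component_eq.
by move=> [u eu Cu] [v ev Dv]; exact: edge_component_eq eu ev Cu Dv.
Qed.

Lemma incident_sub (C D : set G) p : C `<=` D -> incident C p -> incident D p.
Proof.
by move=> CD; case: p => [v|[e s]] /= => [/CD|[v ev /CD Dv]] //; exists v.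
Qed.

(** An edge with an end in a component [C] of G - X has its other end in [C] or in [X], because a
    neighbour outside [X] belongs to [C] as well. *)
Lemma components_nbhdE X (Cs : set (component X)) :
  components_nbhd Cs =
  [set p : complex R G | exists2 C, Cs C & incident (component_set C) p].
Proof.
apply/seteqP; split=> [p|[v|[e s]] [C CsC] /=].
- case=> [[C CsC [[v Cv <-]|[e [s [eC ->]]]]]|
          [e [s [[x [y [Xx [C CsC Cy] eE]]] ->]]]].
  + by exists C.
  + exists C => //=; have [[x y] /= [_ eE]] := edge_ends_ex e.
    have ex : edge_set e x by rewrite eE; left.
    by exists x => //; exact: eC.
  + by exists C => //=; exists y => //; rewrite eE; right.
- by move=> Cv; left; exists C => //; left; exists v.
move=> [y ey Cy]; have [eC|] := pselect (edge_set e `<=` component_set C).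
  by left; exists C => //; right; exists e, s.
move=> /existsNP[x /not_implyP[ex Cx]]; right; exists e, s; split=> //.
have yx : y != x by apply/eqP => yx; apply: Cx; rewrite -yx.
have xX : x \in X.
  by apply: contra_notT Cx; exact: component_adj Cy (edge_adj ey ex yx).
exists x, y; split=> //; first by exists C.
have [[a b] /= [_ eE]] := edge_ends_ex e; move: ex ey yx; rewrite eE.
by move=> [->|->] [->|->]; rewrite ?eqxx //= setUC.
Qed.

Lemma I01_half : `]0, 1[%classic (2^-1 : R).
Proof. by rewrite /= in_itv /= invr_gt0 ltr0n invf_lt1 ?ltr0n // ltr1n. Qed.

(** The set contains each open edge entirely or not at all, and with a vertex every open edge at it.
    Hence any star will do, and the radius 1/2 is arbitrary. *)
Lemma components_nbhd_open X (Cs : set (component X)) :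
  open (components_nbhd Cs : set (complex R G)).
Proof.
rewrite components_nbhdE; split=> [e|v [C CsC /= Cv]].
  have [[C CsC Ce]|nC] := pselect (exists2 C, Cs C &
      exists2 v, edge_set e v & component_set C v).
    by rewrite (_ : [set s | _] = setT) ?eqEsubset;
      [exact: openT | split=> // s _; exists C].
  rewrite (_ : [set s | _] = set0); first exact: open0.
  by apply/seteqP; split.
exists (fun=> exist (fun x => x \in `]0, 1[%classic) _ (mem_set I01_half)).
by case=> [u /= ->|[e s] /= [ev _]]; exists C => //=; exists v.
Qed.

Lemma mem_I01 (t : R) : (t \in (`]0, 1[%classic : set R)) = (0 < t < 1).
Proof.
by apply/idP/idP => [/set_mem|t01]; [|apply/mem_set]; rewrite /= in_itv.
Qed.

Lemma I01_itv (s : I01 R) : 0 < val s < 1.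
Proof. by rewrite -mem_I01; exact: valP. Qed.

Definition edge_tip e : G := (sval (cid (edge_ends_ex e))).2.

Lemma edge_set_ends e : edge_set e = [set edge_origin e; edge_tip e].
Proof.
by rewrite /edge_origin /edge_tip; case: cid => [[x y] []].
Qed.

Lemma edge_tip_origin e : edge_tip e != edge_origin e.
Proof.
rewrite /edge_tip /edge_origin; case: cid => [[x y] [/= xy _]].
by apply: contraTneq xy => ->; rewrite adj_irr.
Qed.

(* The parametrization of the closed edge e by [0, 1], extended to R by
   constants. *)
Definition edge_param e (t : R) : complex R G :=
  match (insub t : option (set_type (`]0, 1[%classic : set R))) with
  | Some s => inr (e, s)
  | None => inl (if t <= 0 then edge_origin e else edge_tip e)
  end.

Lemma edge_param_in e t (tI : t \in (`]0, 1[%classic : set R)) :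
  edge_param e t = inr (e, exist (fun x => x \in `]0, 1[%classic) t tI).
Proof. by rewrite /edge_param insubT. Qed.

Lemma edge_param_le0 e t : t <= 0 -> edge_param e t = inl (edge_origin e).
Proof.
move=> t0; rewrite /edge_param insubF ?t0 //.
by rewrite mem_I01 ltNge t0.
Qed.

Lemma edge_param_ge1 e t : 1 <= t -> edge_param e t = inl (edge_tip e).
Proof.
move=> t1; rewrite /edge_param insubF; last first.
  by rewrite mem_I01 [t < 1]ltNge t1 andbF.
by rewrite leNgt (lt_le_trans ltr01 t1).
Qed.

(** At parameters up to 0 or from 1 on, the half-open interval of a star pulls back to an open
    half-line, whose excess lies where the map is constant. In between, the topology is that of (0,
    1). *)
Lemma edge_param_continuous e : continuous (edge_param e).
Proof.
apply/continuousP => U [Ue Uv]; rewrite openE => t.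
rewrite /interior /= => Ut.
have [t0|t0] := leP t 0.
  move: Ut; rewrite edge_param_le0 // => /Uv[i iU].
  have /andP[i0 i1] : 0 < val (i e) < 1.
    by exact: I01_itv.
  have : nbhs t [set u | u < val (i e)].
    by apply: lt_nbhsl; exact: le_lt_trans i0.
  apply: filterS => u /= ui; apply: iU.
  have [u0|u0] := leP u 0; first by rewrite edge_param_le0.
  have uI : u \in (`]0, 1[%classic : set R).
    by rewrite mem_I01 u0 (lt_trans ui i1).
  rewrite (edge_param_in _ uI) /= /end_dist eqxx; split=> //.
  by rewrite edge_set_ends; left.
have [t1|t1] := leP 1 t.
  move: Ut; rewrite edge_param_ge1 // => /Uv[i iU].
  have /andP[i0 i1] : 0 < val (i e) < 1.
    by exact: I01_itv.
  (* Distances from the tip are [1 - val s], so the inequality is reversed. *)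
  have : nbhs t [set u | val (i e) < u].
    by apply: lt_nbhsr; exact: lt_le_trans t1.
  apply: filterS => u /= ui; apply: iU.
  have [u1|u1] := leP 1 u; first by rewrite edge_param_ge1.
  have uI : u \in (`]0, 1[%classic : set R).
    by rewrite mem_I01 u1 (lt_trans i0 ui).
  rewrite (edge_param_in _ uI) /= /end_dist (negbTE (edge_tip_origin e)).
  split; first by rewrite edge_set_ends; right.
  by rewrite ltrD2l ltrN2.
have tI : t \in (`]0, 1[%classic : set R) by rewrite mem_I01 t0 t1.
have [W Wo WE] := Ue e.
have Wt : W t.
  move: Ut; rewrite (edge_param_in _ tI) => Ut.
  change ((val @^-1` W) (exist (fun x => x \in `]0, 1[%classic) t tI)).
  by rewrite WE.
have : nbhs t (W `&` `]0, 1[%classic).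
  apply: open_nbhs_nbhs; split; last by split=> //; exact: set_mem.
  by apply: openI => //; exact: itv_open.
apply: filterS => u [Wu /mem_set uI]; rewrite /= (edge_param_in _ uI).
have : (val @^-1` W) (exist (fun x => x \in `]0, 1[%classic) u uI) by [].
by rewrite WE.
Qed.

Lemma edge_cover x y : exists K : set (complex R G),
  [/\ compact K, K (inl x) &
      forall e s, edge_set e = [set x; y] -> K (inr (e, s))].
Proof.
have [[e eE]|ne] := pselect (exists e : edge G, edge_set e = [set x; y]).
  (* The image of [0, 1] contains both ends already; adding [inl x] avoids deciding whether [x] is
     the origin or the tip. *)
  exists ([set inl x] `|` edge_param e @` `[0, 1]%classic); split.
  - apply: compactU; first exact: compact_set1.
    apply: continuous_compact; last exact: segment_compact.
    by apply: continuous_subspaceT; exact: edge_param_continuous.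
  - by left.
  (* An edge is its set of ends, so at most one edge joins [x] and [y]. *)
  move=> e' s eE'; have -> : e' = e.
    by apply: val_inj; exact: etrans eE' (esym eE).
  right; exists (val s).
    by have /andP[/ltW s0 /ltW s1] := I01_itv s; rewrite /= in_itv /= s0 s1.
  by rewrite /edge_param valK.
exists [set inl x]; split=> //; first exact: compact_set1.
by move=> e s eE; case: ne; exists e.
Qed.

(* The finite subgraph induced by X is compact. *)
Lemma no_incident_cover X : exists2 K : set (complex R G), compact K &
  forall p, (forall C : component X, ~ incident (component_set C) p) -> K p.
Proof.
have [K KP] := choice (fun xy : G * G => edge_cover xy.1 xy.2).
(* Diagonal pairs take care of the vertices in [X], the other pairs of the edges between them. *)
exists (\bigcup_(xy in [set` (X `*` X)%fset]) K xy).
  rewrite bigcup_fset; apply: bigsetU_compact => xy _.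
  by have [] := KP xy.
have inX v : (forall C : component X, ~ component_set C v) -> v \in X.
  by move=> vC; apply: contraT => /component_ex[C /vC].
case=> [v /= /inX vX|[e s] /= nC].
  by exists (v, v); [rewrite /= in_fsetM vX|have [] := KP (v, v)].
have [[x y] /= [_ eE]] := edge_ends_ex e.
have eX v : edge_set e v -> v \in X.
  by move=> ev; apply: inX => C Cv; apply: (nC C); exists v.
exists (x, y); last by have [_ _] := KP (x, y); exact.
by rewrite /= in_fsetM !eX // eE; [right|left].
Qed.

End Complex.

(** * Topology and compactness of alpha G *)

Section Alpha.
Variables (R : realType) (G : graph) (A : Csystem G).
Implicit Types X : {fset G}.

Lemma alpha_subbase_open (B : set (alpha_space R A)) :
  alpha_subbase B -> open B.
Proof. exact: (@subbase_gen _ (@alpha_subbase R G A)). Qed.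

Lemma alpha_open_inl (U : set (complex R G)) :
  open U -> open (inl @` U : set (alpha_space R A)).
Proof. by move=> Uo; apply: alpha_subbase_open; left; exists U. Qed.

Lemma alpha_nbhd_open X (V : set (csys_space A X)) :
  open V -> open (alpha_nbhd V : set (alpha_space R A)).
Proof.
by move=> Vo; apply: alpha_subbase_open; right; exists X, V.
Qed.

(** Convergence may be tested on the subbase, since filters are closed under finite intersections
    and supersets. *)
Lemma alpha_cvg (F : set_system (alpha_space R A)) (p : alpha_space R A) :
  Filter F -> (forall B, alpha_subbase B -> B p -> F B) -> F --> p.
Proof.
move=> FF FB N; rewrite nbhsE /= => -[W [Wo Wp] WN].
apply: filterS WN _; move: Wp.
apply: (@subbase_ind _ (@alpha_subbase R G A) [set W | W p -> F W]) Wo => //.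
- by move=> _; exact: filterT.
- by move=> B C BF CF [/BF FB' /CF FC]; exact: filterI.
- by move=> I f fF [i _ /(fF i)]; apply: filterS => q fq; exists i.
Qed.

Lemma inl_alpha_continuous : continuous (inl : complex R G -> alpha_space R A).
Proof.
move=> q; have FF := fmap_filter (inl : _ -> alpha_space R A) (nbhs_filter q).
apply: (alpha_cvg FF) => B BB Bq; apply: open_nbhs_nbhs; split=> //.
case: BB => [[U Uo ->]|[X [V [Vo ->]]]].
  rewrite (_ : _ @^-1` _ = U) //.
  by apply/seteqP; split=> [p [_ Up [<-]]|p Up] //; exists p.
rewrite (_ : _ @^-1` _ = components_nbhd (csys_map A (X := X) @^-1` V)).
  exact: components_nbhd_open.
by apply/seteqP; split=> [p [[_ Up [<-]]|[]]|p Up] //; left; exists p.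
Qed.

(** The partial map from alpha G to alpha(C_X), written as a relation because it has no value on the
    points of G[X]. *)
Definition lies_over X (p : alpha_space R A) (z : csys_space A X) : Prop :=
  match p with
  | inl q => exists2 C : component X,
      incident (component_set C) q & csys_map A C = z
  | inr x => csys_proj X x = z
  end.

(** Identifies the generating sets as preimages under the partial map [lies_over], so that
    inclusions and intersections in alpha(C_X) carry over to alpha G. *)
Lemma alpha_nbhdE X (V : set (csys_space A X)) :
  alpha_nbhd V = [set p | exists2 z, lies_over p z & V z].
Proof.
rewrite /alpha_nbhd components_nbhdE; apply/seteqP; split=> [p|[q|x]].
- case=> [[q [C VC Cq] <-]|[x Vx <-]]; last by exists (csys_proj X x).
  by exists (csys_map A C) => //; exists C.
- by move=> [_ [C Cq <-] VC]; left; exists q => //; exists C.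
- by move=> [_ /= <- Vx]; right; exists x.
Qed.

Lemma lies_over_eq X p (y z : csys_space A X) :
  lies_over p y -> lies_over p z -> y = z.
Proof.
case: p => [q|x] /=; last by move=> -> ->.
by move=> [C Cq <-] [D Dq <-]; rewrite (incident_eq Cq Dq).
Qed.

(** For points of G this is the compatibility of the bonding maps with [component_map]; for points
    of the limit it is the thread condition. *)
Lemma lies_over_bond X X' (s : (X `<=` X')%fset) p (z : csys_space A X') :
  lies_over p z -> lies_over p (csys_bond s z).
Proof.
case: p => [q|x] /=; last by move=> <-; rewrite (set_valP x).
move=> [C Cq <-]; exists (component_map s C).
  by apply: incident_sub Cq; exact: component_mapP.
by rewrite -[LHS](csys_bond_map A s C).
Qed.

Lemma alpha_nbhd_bond X X' (s : (X `<=` X')%fset) (V : set (csys_space A X)) :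
  (alpha_nbhd (csys_bond s @^-1` V) : set (alpha_space R A)) `<=` alpha_nbhd V.
Proof.
rewrite !alpha_nbhdE => p [z pz Vz]; exists (csys_bond s z) => //.
exact: lies_over_bond.
Qed.

Lemma alpha_compact : compact [set: alpha_space R A].
Proof.
rewrite compact_ultra => F FU _.
have FF := @ultra_proper _ _ FU.
(* The complement of [alpha_nbhd [set: csys_space A X]] consists of the points over which no value
   is defined, that is, of G[X]. *)
have [[X FX]|nF] := pselect
    (exists X, F (~` alpha_nbhd [set: csys_space A X])).
  have [K Kco KP] := no_incident_cover R X.
  have := continuous_compact (continuous_subspaceT inl_alpha_continuous) Kco.
  rewrite compact_ultra => /(_ F FU)[|p [_ Fp]]; last by exists p.
  apply: filterS FX => p; rewrite alpha_nbhdE; case: p => [q|x] np.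
    exists q => //; apply: KP => C Cq; apply: np.
    by exists (csys_map A C) => //; exists C.
  by case: np; exists (csys_proj X x).
have FT X : F (alpha_nbhd [set: csys_space A X]).
  by have [//|FC] := in_ultra_setVsetC (alpha_nbhd [set: csys_space A X]) FU;
    case: nF; exists X.
(* The push-forward of [F] under the partial map; it is a proper filter because [F] contains the
   domain of that map. *)
pose H X : set_system (csys_space A X) := [set V | F (alpha_nbhd V)].
have HF X : ProperFilter (H X).
  apply: Build_ProperFilter_ex => [V FV|].
    have [p] := @filter_ex _ F FF _ FV.
    by rewrite alpha_nbhdE => -[z _ Vz]; exists z.
  split; first exact: FT.
    rewrite /H => V P /= FV FP; apply: filterS (filterI FV FP) => p.
    rewrite !alpha_nbhdE => -[[y py Vy] [z pz Pz]]; exists y => //; split=> //.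
    by rewrite (lies_over_eq py pz).
  rewrite /H => V P VP /=; apply: filterS => p.
  by rewrite !alpha_nbhdE => -[z pz /VP Pz]; exists z.
have Hlim X : exists z : csys_space A X, H X --> z.
  have [[Kco _ _] _] := csys_compactification A X.
  have [z [_ zH]] := Kco (H X) (HF X) (FT X).
  (* The cluster point [z] is a limit: otherwise the ultrafilter contains the complement of
     [alpha_nbhd N], whose part over alpha(C_X) lies over the complement of [N], and [z] could not
     be a cluster point. *)
  exists z => N zN /=; have [//|FC] := in_ultra_setVsetC (alpha_nbhd N) FU.
  suff /zH/(_ zN)[y []] : H X (~` N) by [].
  rewrite /H /=; apply: filterS (filterI FC (FT X)) => p.
  rewrite !alpha_nbhdE => -[nN [y py _]]; exists y => // Ny.
  by apply: nN; exists y.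
pose z X := sval (cid (Hlim X)).
have zP X : H X --> z X by rewrite /z; case: cid.
have zT : csys_threads z.
  move=> X X' s; have [_ hX] := csys_compactification A X.
  (* By continuity of the bonding map, [H X] also converges to the image of [z X'], and limits in a
     Hausdorff space are unique. *)
  apply: (cvg_unique hX (F := H X)); last exact: zP.
  move=> N nN; have HN : F (alpha_nbhd (csys_bond s @^-1` N)) :=
    zP X' _ (@csys_bond_continuous G A X X' s (z X') N nN).
  by change (F (alpha_nbhd N)); apply: filterS HN; exact: alpha_nbhd_bond.
exists (inr (exist (fun x => x \in @csys_threads G A) z (mem_set zT))).
split=> //.
(* Subbasic sets of the first kind lie inside G and contain no thread. *)
apply: alpha_cvg => _ [[U Uo ->] [? ?]|[X [V [Vo ->]]]] //.
rewrite {1}alpha_nbhdE => -[_ /= <- Vz].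
by apply: zP; exact: open_nbhs_nbhs.
Qed.


(** * The embedding of the end space and the density of its image *)

Lemma csys_iota_inj : injective (@csys_iota G A).
Proof.
move=> w w' /(congr1 val) ww'.
(* Injectivity of each [csys_map] recovers the components in which the ends live; these determine
   the equivalence class of rays. *)
have eC X : end_component X w = end_component X w'.
  have [[_ [minj _ _] _] _] := csys_compactification A X.
  by apply: minj; exact: (congr1 (fun f => f X) ww').
have [r _ wr] := set_valP w; have [r' _ wr'] := set_valP w'.
(* Equivalence of rays is reflexive, so an end contains any ray that represents it. *)
have self (v : Omega G) q : [set q' | ray_equiv q q'] = val v -> end_rays v q.
  by rewrite /end_rays => <- X; have [C qC] := ray_component X q; exists C.
have wP := self _ _ wr; have wP' := self _ _ wr'.
apply: val_inj; rewrite /= -wr -wr'; apply/seteqP; split=> q qr X.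
  exists (end_component X w'); split; first exact: end_componentP.
  by rewrite -eC; apply: end_componentP; rewrite /end_rays -wr.
exists (end_component X w); split; first exact: end_componentP.
by rewrite eC; apply: end_componentP; rewrite /end_rays -wr'.
Qed.

Lemma alpha_map_inj : injective (@alpha_map R G A).
Proof.
move=> [p|w] [q|w'] /= pq; try discriminate pq; first by rewrite (inl_inj pq).
by rewrite (csys_iota_inj (inr_inj pq)).
Qed.

Lemma end_subbase_open (B : set (end_space R G)) :
  end_space_subbase B -> open B.
Proof. exact: (@subbase_gen _ (@end_space_subbase R G)). Qed.

Lemma alpha_map_inl (U : set (complex R G)) :
  @alpha_map R G A @^-1` (inl @` U) = inl @` U.
Proof.
by apply/seteqP; split=> [[p|w] [q Uq] // [<-]|_ [q Uq <-]]; exists q.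
Qed.

Lemma alpha_map_nbhd X (V : set (csys_space A X)) :
  @alpha_map R G A @^-1` alpha_nbhd V = end_nbhd (csys_map A (X := X) @^-1` V).
Proof.
apply/seteqP; split=> [[p|w] [[q Vq] // [<-]|[q Vq] // [qw]]|
                       _ [[q Vq <-]|[w Vw <-]]].
- by left; exists q.
- by right; exists w => //=; move: Vq; rewrite qw.
- by left; exists q.
- by right; exists (csys_iota A w).
Qed.

(** Preimages of subbasic sets are subbasic, which gives continuity. Conversely every subbasic set
    of the end space is such a preimage, hence so is every open set up to the generating
    operations. *)
Lemma alpha_map_embedding : embedding (@alpha_map R G A).
Proof.
split; first exact: alpha_map_inj.
- apply/continuousP => W.
  apply: (@subbase_ind _ (@alpha_subbase R G A)
           [set W | open (@alpha_map R G A @^-1` W)]) => /=.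
  + exact: openT.
  + by move=> U V; exact: openI.
  + by move=> I f fo; rewrite preimage_bigcup; exact: bigcup_open.
  move=> _ [[U Uo ->]|[X [V [Vo ->]]]] /=.
    by rewrite alpha_map_inl; apply: end_subbase_open; left; exists U.
  rewrite alpha_map_nbhd; apply: end_subbase_open; right.
  by exists X, (csys_map A (X := X) @^-1` V).
move=> U Uo.
(* Being a preimage of [W] is enough: the image of that preimage is the trace of [W] on the
   range. *)
suff [W Wo <-] : exists2 W : set (alpha_space R A), open W &
    @alpha_map R G A @^-1` W = U.
  exists W => //.
  apply/seteqP; split=> [_ [p Wp <-]|_ [/[swap] -[p _ <-] Wp]].
    by split=> //; exists p.
  by exists p.
move: U Uo.
apply: (@subbase_ind _ (@end_space_subbase R G)
  [set U | exists2 W : set (alpha_space R A), open W &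
             @alpha_map R G A @^-1` W = U]) => /=.
- by exists setT => //; exact: openT.
- by move=> _ _ [U Uo <-] [V Vo <-]; exists (U `&` V) => //; exact: openI.
- move=> I f fW.
  have /choice[W WP] : forall i, exists W : set (alpha_space R A),
      open W /\ @alpha_map R G A @^-1` W = f i.
    by move=> i; have [W Wo We] := fW i; exists W.
  exists (\bigcup_i W i); first by apply: bigcup_open => i _; have [] := WP i.
  by rewrite preimage_bigcup; apply: eq_bigcupr => i _; have [] := WP i.
move=> _ [[U Uo ->]|[X [Cs ->]]].
  by exists (inl @` U); [exact: alpha_open_inl|exact: alpha_map_inl].
have [[_ [minj _ mopen] _] _] := csys_compactification A X.
(* Every set of components is open in the discrete space C_X, hence the trace of an open set of
   alpha(C_X). *)
have [V Vo CsV] := mopen Cs (discrete_open _).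
exists (alpha_nbhd V); first exact: alpha_nbhd_open.
rewrite alpha_map_nbhd; congr end_nbhd.
apply/seteqP; split=> C /= VC.
  have [D CsD /minj <-//] : (@csys_map G A X @` Cs) (csys_map A C).
  by rewrite CsV; split=> //; exists C.
suff [] : (V `&` range (@csys_map G A X)) (csys_map A C) by [].
by rewrite -CsV; exists C.
Qed.

(* The sets alpha_nbhd form a neighbourhood base at each thread, since X
   ranges over a directed set. *)
Lemma alpha_nbhd_base (W : set (alpha_space R A)) x : open W -> W (inr x) ->
  exists X (V : set (csys_space A X)),
    [/\ open V, V (csys_proj X x) & alpha_nbhd V `<=` W].
Proof.
move=> Wo; move: W Wo x.
apply: (@subbase_ind _ (@alpha_subbase R G A)
  [set W | forall x, W (inr x) -> exists X (V : set (csys_space A X)),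
    [/\ open V, V (csys_proj X x) & alpha_nbhd V `<=` W]]) => /=.
- by move=> x _; exists fset0, setT; split=> //; exact: openT.
- move=> B C BP CP x [/BP[X [V [Vo Vx VB]]] /CP[Y [U [Uo Ux UC]]]].
  have sX : (X `<=` X `|` Y)%fset by exact: fsubsetUl.
  have sY : (Y `<=` X `|` Y)%fset by exact: fsubsetUr.
  have xX : csys_bond sX (csys_proj (X `|` Y)%fset x) = csys_proj X x.
    exact: (set_valP x).
  have xY : csys_bond sY (csys_proj (X `|` Y)%fset x) = csys_proj Y x.
    exact: (set_valP x).
  exists (X `|` Y)%fset, (csys_bond sX @^-1` V `&` csys_bond sY @^-1` U).
  split.
  + apply: openI.
      by move/continuousP : (@csys_bond_continuous G A _ _ sX); exact.
    by move/continuousP : (@csys_bond_continuous G A _ _ sY); exact.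
  + by split; rewrite /= ?xX ?xY.
  move=> p pVU; split; [apply: VB|apply: UC].
    apply: (@alpha_nbhd_bond _ _ sX); move: pVU; rewrite !alpha_nbhdE.
    by move=> [z pz [Vz _]]; exists z.
  apply: (@alpha_nbhd_bond _ _ sY); move: pVU; rewrite !alpha_nbhdE.
  by move=> [z pz [_ Uz]]; exists z.
- move=> I f fP x [i _ /fP[X [V [Vo Vx Vf]]]]; exists X, V; split=> //.
  by move=> p /Vf fp; exists i.
move=> _ [[U Uo ->]|[X [V [Vo ->]]]] x; first by case.
by rewrite {1}alpha_nbhdE => -[_ /= <- Vx]; exists X, V; split.
Qed.

(** By density of C_X in alpha(C_X), a basic neighbourhood of a thread includes a whole component.
    Providing a vertex, rather than any point of G, lets the density argument survive the removal of
    open edges. *)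
Lemma alpha_open_vertex (W : set (alpha_space R A)) x :
  open W -> W (inr x) -> exists v, W (inl (inl v)).
Proof.
move=> Wo /(alpha_nbhd_base Wo)[X [V [Vo Vx VW]]].
have [[_ _ mdense] _] := csys_compactification A X.
have [|y [Vy [C _ CE]]] := mdense V _ Vo; first by exists (csys_proj X x).
have [v Cv] := component_nonempty C; exists v; apply: VW.
by rewrite alpha_nbhdE; exists (csys_map A C); [exists C|rewrite CE].
Qed.

Lemma alpha_map_compactification : compactification (@alpha_map R G A).
Proof.
split; [exact: alpha_compact|exact: alpha_map_embedding|].
move=> W [[p|x] Wp] Wo; first by exists (inl p); split=> //; exists (inl p).
have [v Wv] := alpha_open_vertex Wo Wp.
by exists (inl (inl v)); split=> //; exists (inl (inl v)).
Qed.

(** * Removing the open edges: a Hausdorff compactification *)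

Let E := @end_space_edges R G.
Let AE := @alpha_map R G A @` E.

Lemma alpha_edgesE : AE = inl @` open_edges [set: edge G].
Proof.
apply/seteqP; split=> [_ [_ [p Ep <-] <-]|_ [p Ep <-]]; first by exists p.
by exists (inl p) => //; exists p.
Qed.

(** Makes the rest of alpha G closed, and hence compact. *)
Lemma alpha_edges_open : open AE.
Proof.
rewrite alpha_edgesE; apply: alpha_open_inl; split=> [e|v [e [s []]]] //.
rewrite (_ : [set s | _] = setT) ?eqEsubset; first exact: openT.
by split=> // s _; exists e, s.
Qed.

Lemma alpha_off_edges (p : alpha_space R A) : (~` AE) p ->
  (exists v, p = inl (inl v)) \/ (exists x, p = inr x).
Proof.
rewrite alpha_edgesE; case: p => [[v|[e s]]|x] np.
- by left; exists v.
- by case: np; exists (inr (e, s)) => //; exists e, s.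
- by right; exists x.
Qed.

(** The witness is the vertex together with all open edges at it, of which only the vertex remains
    off the edges. *)
Lemma vertex_isolated v : exists W : set (alpha_space R A),
  [/\ open W, W (inl (inl v)) & forall p, (~` AE) p -> W p -> p = inl (inl v)].
Proof.
pose i0 : I01 R :=
  exist (fun x => x \in `]0, 1[%classic) _ (mem_set (I01_half R)).
exists (inl @` [set q : complex R G | incident [set v] q]); split.
- apply: alpha_open_inl; split=> [e|u /= ->].
    have [ev|nev] := pselect (edge_set e v).
      rewrite (_ : [set s | _] = setT) ?eqEsubset; first exact: openT.
      by split=> // s _; exists v.
    rewrite (_ : [set s | _] = set0); first exact: open0.
    by apply/seteqP; split=> // s [w ew wv]; apply: nev; rewrite -wv.
  exists (fun=> i0) => -[w /= ->//|[e s] /= [ev _]]; by exists v.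
- by exists (inl v).
move=> _ /[swap] -[q qv <-] /alpha_off_edges[[u [qu]]|[x //]].
by move: qv; rewrite qu /= => ->.
Qed.

(** With X = {v}, every thread has a value in alpha(C_X), whereas [v] lies in no component of G -
    v. *)
Lemma alpha_avoid_vertex v : exists W : set (alpha_space R A),
  [/\ open W, ~ W (inl (inl v)) & forall x, W (inr x)].
Proof.
exists (alpha_nbhd [set: csys_space A [fset v]%fset]); split.
- exact/alpha_nbhd_open/openT.
- rewrite alpha_nbhdE => -[z [C /= Cv _] _].
  by have := component_notin Cv; rewrite in_fset1 eqxx.
- by move=> x; rewrite alpha_nbhdE; exists (csys_proj [fset v]%fset x).
Qed.

(** Disjointness is asked for only off the edges, since the stars of two adjacent vertices share an
    open edge. *)
Lemma alpha_off_edges_separated (p q : alpha_space R A) :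
  (~` AE) p -> (~` AE) q -> p <> q -> exists U V : set (alpha_space R A),
  [/\ open U, open V, U p, V q & forall r, (~` AE) r -> U r -> V r -> False].
Proof.
have vertex_sep v s : (~` AE) s -> inl (inl v) <> s ->
    exists U V : set (alpha_space R A), [/\ open U, open V, U (inl (inl v)),
      V s & forall r, (~` AE) r -> U r -> V r -> False].
  move=> ns vs; have [U [Uo Uv UE]] := vertex_isolated v.
  have [V [Vo nVv Vs]] : exists V : set (alpha_space R A),
      [/\ open V, ~ V (inl (inl v)) & V s].
    case: (alpha_off_edges ns) => [[u su]|[x ->]]; last first.
      by have [V [Vo nV Vx]] := alpha_avoid_vertex v; exists V.
    have [V [Vo Vu VE]] := vertex_isolated u; exists V; rewrite su; split=> //.
    move=> Vv; apply: vs; rewrite su; apply: VE => //.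
    by rewrite alpha_edgesE => -[_ [e [t [_ ->]]]].
  by exists U, V; split=> // r nr Ur; rewrite (UE r nr Ur).
move=> np nq; case: (alpha_off_edges np) => [[v ->]|[x px]].
  exact: vertex_sep.
case: (alpha_off_edges nq) => [[v qv] pq|[y qy]].
  have [|U [V [Uo Vo Uv Vp UV]]] := vertex_sep v p np.
    by rewrite -qv => /esym.
  by exists V, U; rewrite qv; split=> // r nr Vr Ur; exact: UV nr Ur Vr.
rewrite px qy => xy.
(* Distinct threads differ in some coordinate; disjoint open sets there pull back to disjoint sets
   because [lies_over] is single-valued. *)
have [X xyX] : exists X, csys_proj X x <> csys_proj X y.
  apply/existsNP => xyE; apply: xy; congr inr; apply: val_inj.
  by apply: functional_extensionality_dep => X; exact: xyE.
have [_] := csys_compactification A X; rewrite open_hausdorff.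
move=> /(_ _ _ (introN eqP xyX))[[U V] /= [/set_mem Ux /set_mem Vy]].
move=> [Uo Vo /eqP UV]; exists (alpha_nbhd U), (alpha_nbhd V).
split; [exact: alpha_nbhd_open|exact: alpha_nbhd_open| | |].
- by rewrite alpha_nbhdE; exists (csys_proj X x).
- by rewrite alpha_nbhdE; exists (csys_proj X y).
move=> r _; rewrite !alpha_nbhdE => -[z rz Uz] [z' rz' Vz'].
suff : (U `&` V) z by rewrite UV.
by split=> //; rewrite (lies_over_eq rz rz').
Qed.

Lemma alpha_off_edges_compactification : hausdorff_compactification
  (embedding_restriction (E := E) alpha_map_embedding).
Proof.
split; first split.
- apply: compact_set_type; apply: subclosed_compact alpha_compact _ => //.
  by rewrite closedC; exact: alpha_edges_open.
- exact: embedding_restriction_embedding.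
- move=> N [p Np] [W Wo WN]; rewrite -WN in Np *.
  (* Density: a nonempty open set contains a vertex, which is a point off the edges. *)
  have [v Wv] : exists v, W (inl (inl v)).
    have := alpha_off_edges (set_valP p).
    move=> [[v pv]|[x px]]; first by exists v; rewrite -pv.
    by apply: (alpha_open_vertex (x := x) Wo); rewrite -px.
  have nE : (~` E) (inl (inl v)) by move=> [_ [e [s [_ ->]]]].
  pose q : set_type (~` E) := exist (fun x => x \in ~` E) _ (mem_set nE).
  by exists (embedding_restriction alpha_map_embedding q); split=> //; exists q.
rewrite open_hausdorff => p q /eqP pq.
have [|U [V [Uo Vo Up Vq UV]]] :=
  @alpha_off_edges_separated (val p) (val q) (set_valP p) (set_valP q).
  by move=> /val_inj /pq.
exists (val @^-1` U, val @^-1` V) => /=; first by split; exact/mem_set.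
split; [by exists U|by exists V|].
by apply/eqP; rewrite -subset0 => r [Ur Vr]; exact: UV (set_valP r) Ur Vr.
Qed.

End Alpha.

Theorem theorem6p7 (R : realType) (G : graph) (A : Csystem G) :
  @Omega_compactification R G (alpha_space R A) (@alpha_map R G A).
Proof.
split; first exact: alpha_map_compactification.
exists (embedding_restriction (@alpha_map_embedding R G A)).
by split=> //; exact: alpha_off_edges_compactification.
Qed.
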